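(* Let $G_{m,n} = \langle a, b \mid [a^m, b^n] = 1\rangle$ with integers $m, n > 1$. Then the submonoid membership problem is undecidable in $G_{m,n}$.
   Context: $\langle A \mid R\rangle$ denotes the group presented by generators $A$ and defining relations $R$; $[x,y]=xyx^{-1}y^{-1}$. The submonoid membership problem in a fixed group $G$ with finite generating set $A$ takes as input words $u,w_1,\dots,w_k$ over $A\cup A^{-1}$ (with $k$ arbitrary), and asks whether the element of $G$ represented by $u$ lies in the submonoid of $G$ generated by the elements represented by $w_1,\dots,w_k$. *)

(* Defs.v *)
From HB Require Import structures.
From mathcomp Require Import all_boot.
From mathcomp Require Import generic_quotient boolp.

Set Implicit Arguments.
Unset Strict Implicit.
Unset Printing Implicit Defensive.

(* ** Words and presented groups *)

(* A letter (x, false) stands for the generator x, and (x, true) for x^-1. *)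
Definition word (T : Type) := seq (T * bool).

Definition winv (T : Type) (w : word T) : word T :=
  rev [seq (l.1, ~~ l.2) | l <- w].

(* The convention is [x, y] = x y x^-1 y^-1, unlike the notation [~ x, y]
   of MathComp, which denotes x^-1 y^-1 x y. *)
Definition wcomm (T : Type) (u v : word T) : word T :=
  u ++ v ++ winv u ++ winv v.

Section PresentedGroup.
Variables (T : choiceType) (R : seq (word T)).

Inductive pres_eq : word T -> word T -> Prop :=
| pres_refl u : pres_eq u u
| pres_sym u v : pres_eq u v -> pres_eq v u
| pres_trans u v w : pres_eq u v -> pres_eq v w -> pres_eq u w
| pres_cat u u' v v' : pres_eq u u' -> pres_eq v v' ->
    pres_eq (u ++ v) (u' ++ v')
| pres_cancel x e : pres_eq [:: (x, e); (x, ~~ e)] [::]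
| pres_rel r : r \in R -> pres_eq r [::].

Definition pres_eqb (u v : word T) : bool := `[< pres_eq u v >].

Lemma pres_eqb_equiv : equiv_class_of pres_eqb.
Proof.
split=> [u|u v|v u w].
- exact/asboolP/pres_refl.
- by apply/asboolP/asboolP; apply: pres_sym.
- by move=> /asboolP uv /asboolP vw; apply/asboolP/(pres_trans uv vw).
Qed.

Canonical pres_eqb_equivRel := EquivRelPack pres_eqb_equiv.

(* The group < T | r = 1 for all r in R >. *)
Definition presented := {eq_quot pres_eqb}%qT.

HB.instance Definition _ := Choice.on presented.
HB.instance Definition _ := EqQuotient.on presented.

Local Open Scope quotient_scope.

Definition pres_one : presented := \pi_presented [::].
Definition pres_mul (x y : presented) : presented :=
  \pi_presented (repr x ++ repr y).
Definition pres_inv (x : presented) : presented :=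
  \pi_presented (winv (repr x)).

Lemma pres_piP u v : \pi_presented u = \pi_presented v <-> pres_eq u v.
Proof.
split=> [/eqmodP/asboolP // | uv].
by apply/eqmodP; apply/asboolP.
Qed.

Lemma pres_repr u : pres_eq (repr (\pi_presented u)) u.
Proof. by apply/pres_piP; rewrite reprK. Qed.

Lemma pres_mulE u v :
  pres_mul (\pi_presented u) (\pi_presented v) = \pi_presented (u ++ v).
Proof. by apply/pres_piP; apply: pres_cat; apply: pres_repr. Qed.

Lemma pres_catV (u : word T) : pres_eq (u ++ winv u) [::].
Proof.
elim: u => [|[x e] u IHu]; first exact: pres_refl.
have -> : ((x, e) :: u) ++ winv ((x, e) :: u) =
    [:: (x, e)] ++ ((u ++ winv u) ++ [:: (x, ~~ e)]).
  by rewrite /winv map_cons rev_cons -cats1 /= catA.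
apply: (pres_trans _ (pres_cancel x e)).
apply: (pres_cat (pres_refl [:: (x, e)])).
exact: (pres_cat IHu (pres_refl [:: (x, ~~ e)])).
Qed.

Lemma winvK : involutive (@winv T).
Proof.
move=> u; rewrite /winv map_rev revK -map_comp -[RHS]map_id.
by apply: eq_map => -[x e] /=; rewrite negbK.
Qed.

Lemma pres_Vcat (u : word T) : pres_eq (winv u ++ u) [::].
Proof. by have := pres_catV (winv u); rewrite winvK. Qed.

Lemma pres_surj (x : presented) : x = \pi_presented (repr x).
Proof. by rewrite reprK. Qed.

Lemma pres_mulA : associative pres_mul.
Proof.
move=> x y z; rewrite (pres_surj x) (pres_surj y) (pres_surj z).
by rewrite 2!(pres_mulE (repr _)) 2!(pres_mulE _ (repr _)) catA.
Qed.

Lemma pres_mul1 : left_id pres_one pres_mul.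
Proof. by move=> x; rewrite (pres_surj x) pres_mulE. Qed.

Lemma pres_mulr1 : right_id pres_one pres_mul.
Proof. by move=> x; rewrite (pres_surj x) pres_mulE cats0. Qed.

Lemma pres_mulV : left_inverse pres_one pres_inv pres_mul.
Proof.
move=> x; rewrite [X in pres_mul _ X]pres_surj pres_mulE.
exact/pres_piP/pres_Vcat.
Qed.

Lemma pres_mulrV : right_inverse pres_one pres_inv pres_mul.
Proof.
move=> x; rewrite [X in pres_mul X _]pres_surj pres_mulE.
exact/pres_piP/pres_catV.
Qed.

HB.instance Definition _ := isGroup.Build presented
  pres_mulA pres_mul1 pres_mulr1 pres_mulV pres_mulrV.

Definition pres_gen (x : T) : presented := \pi_presented [:: (x, false)].

End PresentedGroup.

(* ** The submonoid membership problem *)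

Local Open Scope group_scope.

Inductive submonoid_gen (M : monoidType) (s : seq M) : M -> Prop :=
| submonoid_one : submonoid_gen s 1
| submonoid_mem x : x \in s -> submonoid_gen s x
| submonoid_mul x y :
    submonoid_gen s x -> submonoid_gen s y -> submonoid_gen s (x * y).

Definition word_value (G : groupType) (T : Type) (gen : T -> G)
    (w : word T) : G :=
  \prod_(l <- w) (if l.2 then (gen l.1)^-1 else gen l.1).

(* An instance is a pair (u, [:: w_1; ...; w_k]). *)
Definition submonoid_membership (G : groupType) (T : finType) (gen : T -> G)
    (i : word T * seq (word T)) : Prop :=
  submonoid_gen [seq word_value gen w | w <- i.2] (word_value gen i.1).

Local Close Scope group_scope.

(* ** Decidability, through Kleene's partial recursive functions *)

Inductive recfun : nat -> Type :=
| RZero n : recfun n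
| RSucc : recfun 1
| RProj n (i : 'I_n) : recfun n
| RComp k n (f : recfun k) (g : 'I_k -> recfun n) : recfun n
| RPrim n (f : recfun n) (g : recfun n.+2) : recfun n.+1
| RMu n (f : recfun n.+1) : recfun n.

(* rec_eval f v y : the partial function f is defined at v, with value y.
   - RPrim f g is h with h(0, v) = f(v) and h(i+1, v) = g(i, h(i, v), v);
     the function s below lists the successive values h(0, v), h(1, v), ...
   - RMu f maps v to the least y such that f(y, v) = 0, where moreover
     f(i, v) is required to be defined for all i < y. *)
Fixpoint rec_eval n (f : recfun n) : n.-tuple nat -> nat -> Prop :=
  match f in recfun n return n.-tuple nat -> nat -> Prop with
  | RZero _ => fun _ y => y = 0
  | RSucc => fun v y => y = (thead v).+1
  | RProj _ i => fun v y => y = tnth v i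
  | RComp k _ f g => fun v y =>
      exists2 w : k.-tuple nat,
        forall i, rec_eval (g i) v (tnth w i) & rec_eval f w y
  | RPrim _ f g => fun v y =>
      exists s : nat -> nat,
        [/\ rec_eval f [tuple of behead v] (s 0),
            forall i, i < thead v ->
              rec_eval g [tuple of [:: i, s i & behead v]] (s i.+1)
          & y = s (thead v)]
  | RMu _ f => fun v y =>
      rec_eval f [tuple of y :: v] 0 /\
      forall i, i < y -> exists z, rec_eval f [tuple of i :: v] z.+1
  end.

(* P is decidable if its characteristic function is recursive, instances
   being represented by their Goedel number pickle. The property depends on
   the coding only up to a recursive change of coding; the coding that
   MathComp provides for pairs and sequences over a finite type is
   effective. *)
Definition recursively_decidable (I : countType) (P : I -> Prop) : Prop :=
  exists f : recfun 1, forall i : I,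
    (P i -> rec_eval f [tuple pickle i] 1) /\
    (~ P i -> rec_eval f [tuple pickle i] 0).

(* ** The groups < a, b | [a^m, b^n] = 1 > *)

Definition gen_a : bool := false.
Definition gen_b : bool := true.

Definition Gmn_relators (m n : nat) : seq (word bool) :=
  [:: wcomm (nseq m (gen_a, false)) (nseq n (gen_b, false))].

Definition Gmn (m n : nat) : groupType := presented (Gmn_relators m n).

Definition Gmn_gen (m n : nat) : bool -> Gmn m n :=
  @pres_gen bool (Gmn_relators m n).

(* Main.v *)
From HB Require Import structures.
Require Import Defs.
From mathcomp Require Import all_boot.
From mathcomp Require Import generic_quotient boolp zify.

(** The proof reduces the vanishing of recursive functions to submonoid
    membership, and concludes by diagonalization.

    Geometry. The elements [a^m] and [b^n] commute, and so do any two of their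
    conjugates by a common element. Conjugating them by the prefixes of
    [a b a b ...] yields [v_0 = a^m], [v_1 = a b^n a^-1],
    [v_2 = a b a^m b^-1 a^-1], ... such that [v_k] commutes with [v_(k+1)]
    ([vertex_word_commute]). Conversely, permutations [V_k] of a set such that
    [V_k] commutes with [V_(k+1)] always come from an action of the group
    ([tact_expand]), so the [v_k] satisfy no further relation; this is the
    right-angled Artin group on an infinite path. Non-membership is proved by
    exhibiting a subset that is stable under the generators of the submonoid
    ([expand_submonoid]).

    Machines. A machine with states and one counter is given by rules
    [(q, P k + i) -> (q', A k + B)]. Let [d, c, b, a] be [v_0, v_1, v_2, v_3]:
    only the neighbours in [a - b - c - d] commute. Let [s_p] be further
    elements [v_6, v_8, ...], one for each control state [p]; a generator
    [s_p x s_q^-1] means: do [x] while passing from state [p] to state [q].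
    A run from [N_0] is written as the product of the words
    [a b^N_j c^N_(j+1) d]; the rules produce the two exponents together, in
    pieces [b^P c^A]. As [b] commutes with [a], and [c] with [d], this product
    is [b^N_0 (a d) (c b)^N_1 (a d) (c b)^N_2 ...], and the exponents [N_j]
    written by one step and read by the next are equal exactly when it can be
    undone by the fixed generators [s x s^-1] with [x = d^-1 a^-1] or
    [x = c^-1 b^-1]. Hence [s_q0 c^-N_0 s^-1] lies in the submonoid if and only
    if the run from [N_0] ends ([query_member]). For the direct implication,
    the letters [a, c] push on one stack and [b, d] on another; undoing both
    stacks by the same word compares their contents.

    Computability. A recursive function is compiled to a program with
    registers, and the registers are stored as the exponents of distinct primes
    in the counter. The machine is deterministic and is needed only at
    arguments where the function is defined, so it is enough to follow the
    execution that exists ([zero_machine_rec]): it reaches the final state if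
    and only if the value is zero.

    Diagonal argument. If [f] decided the problem, then so would the recursive
    function mapping [x] to the answer of [f] on the query for [2^x] and the
    list of generators of code [x]. The machine testing this value for zero has
    a list of generators; taking [x] to be the code of that list, the machine
    stops if and only if the answer is no, that is if and only if it does not
    stop. *)

Set Implicit Arguments.
Unset Strict Implicit.
Unset Printing Implicit Defensive.

(** * Words, their values in a presented group, and actions *)

Lemma winv_cat (T : Type) (u v : word T) : winv (u ++ v) = winv v ++ winv u.
Proof. by rewrite /winv map_cat rev_cat. Qed.

Lemma winv_cons (T : Type) (l : T * bool) (w : word T) :
  winv (l :: w) = winv w ++ [:: (l.1, ~~ l.2)].
Proof. by rewrite -cat1s winv_cat. Qed.

Section Values.
Local Open Scope group_scope.
Local Open Scope quotient_scope.
Variables (T : choiceType) (R : seq (word T)).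

Definition gval (w : word T) : presented R := \pi_(presented R) w.

Lemma gval_cat u v : gval (u ++ v) = gval u * gval v.
Proof. by rewrite /gval -pres_mulE. Qed.

Lemma gval_winv w : gval (winv w) = (gval w)^-1.
Proof.
by apply/esym/mulg1_eq; rewrite -gval_cat; apply/pres_piP/pres_catV.
Qed.

Lemma gval_nseq l k : gval (nseq k l) = gval [:: l] ^+ k.
Proof. by elim: k => [|k IHk] //; rewrite expgS -IHk -gval_cat. Qed.

Lemma gval_repr (g : presented R) : gval (repr g) = g.
Proof. exact: reprK. Qed.

Lemma word_value_gval w : word_value (@pres_gen T R) w = gval w.
Proof.
rewrite /word_value; elim: w => [|[x e] w IHw]; first by rewrite big_nil.
rewrite big_cons IHw -cat1s gval_cat; congr (_ * _).
by case: e => //=; rewrite -[(pres_gen _ _)^-1]gval_winv.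
Qed.

End Values.

Section WordAction.
Variables (T : choiceType) (X : Type) (F B : T -> X -> X).

Definition letter_act (l : T * bool) : X -> X := if l.2 then B l.1 else F l.1.

(** Words act on the right: the first letter is applied first. *)
Definition act (w : word T) (x : X) : X := foldl (fun y l => letter_act l y) x w.

Lemma act_cat u v x : act (u ++ v) x = act v (act u x).
Proof. exact: foldl_cat. Qed.

Lemma act_nseq l k x : act (nseq k l) x = iter k (letter_act l) x.
Proof. by elim: k x => // k IHk x; rewrite iterSr -IHk. Qed.

Hypotheses (FK : forall t, cancel (F t) (B t)).
Hypotheses (BK : forall t, cancel (B t) (F t)).

Lemma act_winvK w : cancel (act w) (act (winv w)).
Proof.
elim: w => [|[t e] w IHw] x //.
by rewrite winv_cons act_cat /= IHw; case: e; [apply: BK|apply: FK].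
Qed.

End WordAction.

Section PresentedAction.
Variables (T : choiceType) (R : seq (word T)) (X : Type).
Variables F B : T -> X -> X.
Hypotheses (FK : forall t, cancel (F t) (B t)).
Hypotheses (BK : forall t, cancel (B t) (F t)).
Hypothesis relators_act : forall r, r \in R -> act F B r =1 id.

Lemma act_pres_eq u v : pres_eq R u v -> act F B u =1 act F B v.
Proof.
elim=> {u v} [u|u v _ IH|u v w _ IH1 _ IH2|u u' v v' _ IH1 _ IH2|t e|r rR] x //.
- by rewrite IH1.
- by rewrite !act_cat IH1.
- by case: e; [apply: BK|apply: FK].
- exact: relators_act.
Qed.

(** A subset stable under the generators of a submonoid is stable under the
    submonoid: this is how non-membership is established. *)
Lemma submonoid_act (S : X -> Prop) (ws : seq (word T)) u :
    (forall w, w \in ws -> forall x, S x -> S (act F B w x)) ->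
    submonoid_gen [seq gval R w | w <- ws] (gval R u) ->
  forall x, S x -> S (act F B u x).
Proof.
move=> stableS; have [g gu] : exists g, g = gval R u by exists (gval R u).
rewrite -gu => gen; elim: gen u gu => {g} [|g /mapP[w w_ws ->]|g h _ IHg _ IHh] u gu x Sx.
- by rewrite (@act_pres_eq u [::]) //; apply/pres_piP.
- rewrite -(@act_pres_eq w u) //; first exact: stableS.
  exact/pres_piP.
rewrite -(@act_pres_eq (repr g ++ repr h) u); last first.
  by apply/pres_piP; rewrite -/(gval R _) gval_cat !gval_repr.
by rewrite act_cat; apply: IHh (esym (gval_repr _)) _ _; apply: IHg (esym (gval_repr _)) _ _.
Qed.

End PresentedAction.

(** * A right-angled Artin group on an infinite path inside the group *)

Section Tree.
Variables (m n : nat).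

Let sz (k : nat) := if odd k then n else m.
Let rels := Gmn_relators m n.

(** In the Bass-Serre tree of the quotient [Z/m * Z/n], the word [path_word k]
    leads from a base edge to the [k]-th vertex of a ray, and [vertex_word k] is
    the conjugate of [a^m] or [b^n] that belongs to this vertex. *)
Definition path_word (k : nat) : word bool := mkseq (fun i => (odd i, false)) k.

Definition vertex_word (k : nat) : word bool :=
  path_word k ++ nseq (sz k) (odd k, false) ++ winv (path_word k).

Definition expand (W : word nat) : word bool :=
  flatten [seq if l.2 then winv (vertex_word l.1) else vertex_word l.1 | l <- W].

Lemma expand_cat U W : expand (U ++ W) = expand U ++ expand W.
Proof. by rewrite /expand map_cat flatten_cat. Qed.

Lemma path_wordS k : path_word k.+1 = path_word k ++ [:: (odd k, false)].
Proof. by rewrite /path_word mkseqS -cats1. Qed.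

Section Commute.
Local Open Scope group_scope.

Lemma gval_relator :
  commute (gval rels [:: (gen_a, false)] ^+ m) (gval rels [:: (gen_b, false)] ^+ n).
Proof.
have : gval rels (wcomm (nseq m (gen_a, false)) (nseq n (gen_b, false))) = 1.
  by apply/pres_piP/pres_rel; rewrite inE.
rewrite /wcomm !gval_cat !gval_winv !gval_nseq mulgA => /eqP.
by rewrite mulgA !divg_eq1 divg_eq => /eqP.
Qed.

Lemma gval_powers_commute k :
  commute (gval rels [:: (odd k, false)] ^+ sz k)
          (gval rels [:: (odd k.+1, false)] ^+ sz k.+1).
Proof.
rewrite /sz /=; case: (odd k) => /=; last exact: gval_relator.
exact/commute_sym/gval_relator.
Qed.

(** Both words are conjugates by the same path word, of the powers
    [x^p] and [x y^q x^-1] respectively, where [x^p] commutes with [x]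
    and with [y^q]. *)
Lemma vertex_word_commute k :
  commute (gval rels (vertex_word k)) (gval rels (vertex_word k.+1)).
Proof.
set x := gval rels [:: (odd k, false)].
set y := gval rels [:: (odd k.+1, false)].
set g := gval rels (path_word k).
have -> : gval rels (vertex_word k) = g * x ^+ sz k * g^-1.
  by rewrite /vertex_word !gval_cat gval_winv gval_nseq mulgA.
have -> : gval rels (vertex_word k.+1) = g * (x * y ^+ sz k.+1 * x^-1) * g^-1.
  rewrite /vertex_word path_wordS winv_cat !gval_cat !gval_winv gval_nseq.
  by rewrite -/x -/y -/g !mulgA.
have xC : commute (x ^+ sz k) x by apply/commute_sym/commuteX.
have xyC : commute (x ^+ sz k) (x * y ^+ sz k.+1 * x^-1).
  apply: commuteM; last exact: commuteV.
  by apply: commuteM => //; apply: gval_powers_commute.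
move: (x ^+ sz k) (x * _ * _) xyC => p q pq.
by rewrite /commute !mulgA !mulgVK -!(mulgA g) pq.
Qed.

End Commute.

Section TreeAction.
Variables (Y : Type) (V V' : nat -> Y -> Y).
Hypotheses (VK : forall k, cancel (V k) (V' k)).
Hypotheses (VK' : forall k, cancel (V' k) (V k)).
Hypothesis V_commute : forall k y, V k (V k.+1 y) = V k.+1 (V k y).
Hypotheses (hm : 1 < m) (hn : 1 < n).

Let X := (Y * (nat * nat))%type.

(** The group acts on copies of [Y] indexed by the points of a chain of cycles:
    the cycle [k] has [sz k] points and meets the cycle [k.+1] in one point,
    which is at position 1 on the former and 0 on the latter. The generator of
    parity [odd k] rotates the cycle [k], and applies [V k] when it comes back
    to position 0, so that its power [sz k] is [V k] on the whole cycle.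
    Points are named by their nonzero position on a cycle, apart from the first
    one, [(0, 0)]; the other pairs of naturals are fixed. *)
Definition point (k p : nat) : nat * nat :=
  if p is 0 then (if k is k'.+1 then (k', 1) else (0, 0)) else (k, p).

(** The cycle of the generator [g] through a point, with the position on it. *)
Definition locate (g : bool) (c : nat * nat) : option (nat * nat) :=
  if odd c.1 == g then
    if (c.2 < sz c.1) && ((0 < c.2) || (c.1 == 0)) then Some c else None
  else if c.2 == 1 then Some (c.1.+1, 0) else None.

Arguments point : simpl never.
Arguments locate : simpl never.

Definition turn (g : bool) (x : X) : X :=
  if locate g x.2 is Some (k, p) then
    if p.+1 < sz k then (x.1, point k p.+1) else (V k x.1, point k 0)
  else x.

Definition turn_back (g : bool) (x : X) : X :=
  if locate g x.2 is Some (k, p) then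
    if p is p'.+1 then (x.1, point k p') else (V' k x.1, point k (sz k).-1)
  else x.

Lemma sz_gt1 k : 1 < sz k. Proof. by rewrite /sz; case: ifP. Qed.

Lemma locate_point k p : p < sz k -> locate (odd k) (point k p) = Some (k, p).
Proof.
case: p => [|p] lt_p; rewrite /locate /point /=; last by rewrite eqxx lt_p.
case: k lt_p => [|k] lt_p /=; first by rewrite lt_p.
by case: (odd k).
Qed.

Lemma locateP g c k p : locate g c = Some (k, p) ->
  [/\ odd k = g, p < sz k & c = point k p].
Proof.
case: c => i j; rewrite /locate /=; case: eqP => [<-|ig].
  case: ifP => // /andP[lt_j j_gt0] [<- <-]; split=> //.
  by case: j {lt_j} j_gt0 => [|j] //=; case: i.
case: eqP => // -> [<- <-]; split => //=; first by case: g (odd i) ig => [] [].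
exact: ltnW (sz_gt1 i.+1).
Qed.

Lemma turnK g : cancel (turn g) (turn_back g).
Proof.
case=> y c; rewrite /turn; case E: (locate g c) => [[k p]|] /=; last first.
  by rewrite /turn_back E.
have [kg lt_p ->] := locateP E; have sz_gt0 := ltnW (sz_gt1 k).
rewrite /turn_back -kg; case: ltnP => lt_p1 /=; first by rewrite locate_point.
rewrite (locate_point sz_gt0) VK.
by have /eqP <- : p.+1 == sz k by rewrite eqn_leq lt_p.
Qed.

Lemma turn_backK g : cancel (turn_back g) (turn g).
Proof.
case=> y c; rewrite /turn_back; case E: (locate g c) => [[k p]|]; last first.
  by rewrite /turn E.
have [kg lt_p ->] := locateP E; have sz_gt0 := ltnW (sz_gt1 k).
rewrite /turn -kg; case: p lt_p {E} => [|p] lt_p.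
  by rewrite locate_point ?prednK ?leqnn ?ltnn // VK'.
by rewrite locate_point ?lt_p // ltnW.
Qed.

Lemma iter_turn k y p : p < sz k ->
  iter p (turn (odd k)) (y, point k 0) = (y, point k p).
Proof.
elim: p => [|p IHp] // lt_p; rewrite iterS IHp; last exact: ltnW.
by rewrite /turn locate_point ?lt_p // ltnW.
Qed.

(** The result has to be the same at all positions of the cycle, for these
    powers to commute where two cycles meet. *)
Lemma iter_turn_full k y p : p < sz k ->
  iter (sz k) (turn (odd k)) (y, point k p) = (V k y, point k p).
Proof.
move=> lt_p; rewrite -(iter_turn y lt_p) -iterD addnC iterD.
have sz_gt0 := ltnW (sz_gt1 k).
have -> : iter (sz k) (turn (odd k)) (y, point k 0) = (V k y, point k 0).
  rewrite -(prednK sz_gt0) iterS iter_turn ?prednK // /turn locate_point ?prednK //.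
  by rewrite ltnn.
exact: iter_turn.
Qed.

Definition around (g : bool) (c : nat * nat) : Y -> Y :=
  if locate g c is Some (k, _) then V k else id.

Lemma iter_turn_around g y c :
  iter (if g then n else m) (turn g) (y, c) = (around g c y, c).
Proof.
rewrite /around; case E: (locate g c) => [[k p]|]; last first.
  by elim: (X in iter X) => // i IHi; rewrite iterS IHi /turn E.
by have [<- lt_p ->] := locateP E; apply: iter_turn_full.
Qed.

(** Cycles of opposite parity through the same point are consecutive. *)
Lemma around_commute c y :
  around false c (around true c y) = around true c (around false c y).
Proof.
case: c => i j; rewrite /around /locate /=.
by case: (odd i) => /=; case: (_ && _); case: (j == 1) => //=; rewrite V_commute.
Qed.

Notation tact := (act turn turn_back).

Lemma tact_relators r : r \in rels -> tact r =1 id.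
Proof.
rewrite inE => /eqP -> x; rewrite /wcomm !act_cat.
rewrite -[RHS](act_winvK turnK turn_backK (nseq n (gen_b, false) ++ nseq m (gen_a, false))).
rewrite winv_cat !act_cat; do 2!congr act; case: x => y c.
rewrite !act_nseq (iter_turn_around false) (iter_turn_around true).
by rewrite (iter_turn_around true) (iter_turn_around false) around_commute.
Qed.

Lemma tact_path k y : tact (path_word k) (y, (0, 0)) = (y, point k 0).
Proof.
elim: k => // k IHk; rewrite path_wordS act_cat IHk /= /letter_act /=.
by rewrite /turn locate_point ?sz_gt1 // ltnW // sz_gt1.
Qed.

Lemma tact_path_winv k y :
  tact (winv (path_word k)) (y, point k 0) = (y, (0, 0)).
Proof. by rewrite -tact_path (act_winvK turnK turn_backK). Qed.

Lemma tact_vertex k y : tact (vertex_word k) (y, (0, 0)) = (V k y, (0, 0)).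
Proof.
rewrite /vertex_word !act_cat tact_path act_nseq /letter_act /=.
by rewrite iter_turn_full ?tact_path_winv // ltnW // sz_gt1.
Qed.

Lemma tact_expand W y : tact (expand W) (y, (0, 0)) = (act V V' W y, (0, 0)).
Proof.
elim: W y => [|[k e] W IHW] y //; rewrite /expand /= act_cat.
case: e => /=; last by rewrite tact_vertex IHW.
rewrite -[in LHS](VK' k y) -tact_vertex (act_winvK turnK turn_backK) IHW.
by rewrite /letter_act /=.
Qed.

(** To refute membership in a submonoid generated by words in the [v_k], it is
    enough to let the [v_k] act by permutations commuting along the path. *)
Lemma expand_submonoid (S : Y -> Prop) (Ws : seq (word nat)) U :
    (forall W, W \in Ws -> forall y, S y -> S (act V V' W y)) ->
    submonoid_gen [seq gval rels w | w <- map expand Ws] (gval rels (expand U)) ->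
  forall y, S y -> S (act V V' U y).
Proof.
move=> stableS genU y Sy.
have := submonoid_act turnK turn_backK tact_relators
  (S := fun x => S x.1 /\ x.2 = (0, 0)) _ genU.
case/(_ _ (y, (0, 0))) => //.
- move=> _ /mapP[W W_Ws ->] [z c] /= [Sz ->].
  by rewrite tact_expand; split=> //; apply: stableS.
- by rewrite tact_expand.
Qed.

End TreeAction.
End Tree.

(** * Affine one-counter machines *)

(** A rule rewrites the counter value [modulus * k + residue], in state [src],
    to [factor * k + shift], in state [dst]. *)
Record affine_rule := AffineRule {
  src : nat; modulus : nat; factor : nat;
  residue : nat; shift : nat; dst : nat }.

Definition rule_tuple r :=
  (src r, modulus r, factor r, residue r, shift r, dst r).
Definition tuple_rule t :=
  let: (q, p, a, i, b, q') := t in AffineRule q p a i b q'.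
Lemma rule_tupleK : cancel rule_tuple tuple_rule.
Proof. by case. Qed.
HB.instance Definition _ := Equality.copy affine_rule (can_type rule_tupleK).

Inductive step (R : seq affine_rule) : nat * nat -> nat * nat -> Prop :=
| Step r k : r \in R ->
  step R (src r, modulus r * k + residue r) (dst r, factor r * k + shift r).

Inductive steps (R : seq affine_rule) : nat * nat -> nat * nat -> Prop :=
| Steps0 c : steps R c c
| StepsS c d e : step R c d -> steps R d e -> steps R c e.

Lemma steps_trans R c d e : steps R c d -> steps R d e -> steps R c e.
Proof. by elim=> // {c d} b c d bc _ IH /IH; apply: StepsS. Qed.

Lemma steps_step R c d e : steps R c d -> step R d e -> steps R c e.
Proof. by move=> cd de; apply: steps_trans cd _; apply: StepsS de (Steps0 _ _). Qed.

(** * Stacks *)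

(** Pushing a letter has to be a permutation. A letter popped from a stack that
    does not have it on top leads to an infinite chain of bad values, from which
    only pushing the same letter comes back. In [Bad x o k], the letter [x] was
    popped [k.+1] times; [o] is [None] if the stack was empty, and [Some t] if
    it was [~~ x :: t]. *)
Inductive stack :=
| Good of seq bool
| Bad of bool & option (seq bool) & nat.

Definition push (x : bool) (s : stack) : stack :=
  match s with
  | Good t => Good (x :: t)
  | Bad y o k =>
    if y == x then
      if k is k'.+1 then Bad y o k'
      else Good (if o is Some t then ~~ y :: t else [::])
    else s
  end.

Definition pop (x : bool) (s : stack) : stack :=
  match s with
  | Good [::] => Bad x None 0
  | Good (y :: t) => if y == x then Good t else Bad x (Some t) 0
  | Bad y o k => if y == x then Bad y o k.+1 else s
  end.

Lemma pushK x : cancel (push x) (pop x).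
Proof.
case=> [t|y o k] /=; first by rewrite eqxx.
case: eqP => [->|/eqP/negPf yx] /=; last by rewrite yx.
by case: k => [|k] /=; rewrite ?eqxx //; case: o => [t|] //; case: x.
Qed.

Lemma popK x : cancel (pop x) (push x).
Proof.
case=> [[|y t]|y o k] /=; first by rewrite eqxx.
  case: eqP => [-> //|yx] /=; rewrite eqxx.
  by congr (Good (_ :: _)); case: x y yx => [] [].
by case: eqP => [->|/eqP/negPf yx] /=; rewrite ?eqxx ?yx.
Qed.

Definition bad (s : stack) : bool := if s is Bad _ _ _ then true else false.

Lemma bad_pop x s : bad s -> bad (pop x s).
Proof. by case: s => //= y o k _; case: ifP. Qed.

Lemma iter_pop k t : iter k (pop false) (Good (nseq k false ++ t)) = Good t.
Proof. by elim: k => // k IHk; rewrite iterSr. Qed.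

(** * The permutations attached to the vertices of the path *)

(** The letters [a, c] act on the first stack and [b, d] on the second one. The
    permutations of [a] and [d] commute, unlike these elements of the group; the
    comparison of the two stacks is still faithful enough. *)
Definition memory := (stack * stack)%type.

Notation va := 3.
Notation vb := 2.
Notation vc := 1.
Notation vd := 0.

Definition store (k : nat) (h : memory) : memory :=
  match k with
  | vd => (h.1, push true h.2)
  | vc => (push false h.1, h.2)
  | vb => (h.1, push false h.2)
  | va => (push true h.1, h.2)
  | _ => h
  end.

Definition unstore (k : nat) (h : memory) : memory :=
  match k with
  | vd => (h.1, pop true h.2)
  | vc => (pop false h.1, h.2)
  | vb => (h.1, pop false h.2)
  | va => (pop true h.1, h.2)
  | _ => h
  end.

Lemma storeK k : cancel (store k) (unstore k).
Proof. by move=> [s t]; do 4?case: k => [|k] /=; rewrite ?pushK. Qed.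

Lemma unstoreK k : cancel (unstore k) (store k).
Proof. by move=> [s t]; do 4?case: k => [|k] /=; rewrite ?popK. Qed.

(** The memory is accessible only when the control is [None]. The permutation
    [enter k] shifts the two-sided sequence
    [..., Some (k, (false, 0)), None, Some (k, (true, 0)), ...]
    and fixes the rest; between two generators, the control stays on the left
    half [Some (k, (false, t))] of one of these sequences. *)
Definition control := option (nat * (bool * nat)).

Definition enter (k : nat) (z : control) : control :=
  match z with
  | None => Some (k, (true, 0))
  | Some (j, (b, t)) =>
    if j == k then
      match b, t with
      | true, t => Some (j, (true, t.+1))
      | false, t'.+1 => Some (j, (false, t'))
      | false, 0 => None
      end
    else z
  end.

Definition leave (k : nat) (z : control) : control :=
  match z with
  | None => Some (k, (false, 0))
  | Some (j, (b, t)) =>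
    if j == k then
      match b, t with
      | false, t => Some (j, (false, t.+1))
      | true, t'.+1 => Some (j, (true, t'))
      | true, 0 => None
      end
    else z
  end.

Lemma enterK k : cancel (enter k) (leave k).
Proof.
case=> [[j [b t]]|] /=; last by rewrite eqxx.
by case: eqP => [->|/eqP/negPf jk]; case: b t => [] [|t] /=; rewrite ?eqxx ?jk.
Qed.

Lemma leaveK k : cancel (leave k) (enter k).
Proof.
case=> [[j [b t]]|] /=; last by rewrite eqxx.
by case: eqP => [->|/eqP/negPf jk]; case: b t => [] [|t] /=; rewrite ?eqxx ?jk.
Qed.

Definition config := (memory * control)%type.

(** The bound 6 leaves two inert vertices between the four data letters and the
    states, and the odd vertices beyond it separate the states, so that no
    commutation constrains them. *)
Definition perm (k : nat) (y : config) : config :=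
  if k < 6 then if y.2 is None then (store k y.1, None) else y
  else if odd k then y else (y.1, enter k y.2).

Definition perm_inv (k : nat) (y : config) : config :=
  if k < 6 then if y.2 is None then (unstore k y.1, None) else y
  else if odd k then y else (y.1, leave k y.2).

Lemma permK k : cancel (perm k) (perm_inv k).
Proof.
case=> h z; rewrite /perm; case: ltnP => k6.
  by case: z => [z|]; rewrite /perm_inv k6 //= storeK.
by case: ifP => ok; rewrite /perm_inv ltnNge k6 /= ok ?enterK.
Qed.

Lemma perm_invK k : cancel (perm_inv k) (perm k).
Proof.
case=> h z; rewrite /perm_inv; case: ltnP => k6.
  by case: z => [z|]; rewrite /perm k6 //= unstoreK.
by case: ifP => ok; rewrite /perm ltnNge k6 /= ok ?leaveK.
Qed.

Lemma perm_commute k y : perm k (perm k.+1 y) = perm k.+1 (perm k y).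
Proof.
have perm5 z : perm 5 z = z by case: z => h [].
case: y => h z; do 5![case: k => [|k]; first by case: z].
case: k => [|k]; first by rewrite !perm5.
by rewrite /perm /= negbK; case: (odd k).
Qed.

(** * The submonoid attached to a machine *)

(** Besides the states of the machine, there is one state for each rule being
    applied, and two for the end: [Drop] removes the last counter value, and
    [Check] undoes the history. *)
Inductive state := St of nat | Mid of nat | Drop | Check.

Definition state_code (p : state) : nat :=
  match p with
  | Check => 0
  | Drop => 1
  | St q => q.*2.+2
  | Mid j => j.*2.+3
  end.

Lemma state_code_inj : injective state_code.
Proof. by case=> [q|j||] [q'|j'||] //= H; (lia || (f_equal; lia)). Qed.

Definition state_vertex (p : state) : nat := (state_code p).*2 + 6.

Definition token (p : state) (W : word nat) (q : state) : word nat :=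
  (state_vertex p, false) :: W ++ [:: (state_vertex q, true)].

Section Machine.
Variables (R : seq affine_rule) (final : nat).

Definition mid (r : affine_rule) := Mid (index r R).

Definition rule_tokens (r : affine_rule) : seq (word nat) :=
  [:: token (St (src r)) [:: (va, false)] (mid r);
      token (mid r) (nseq (modulus r) (vb, false) ++ nseq (factor r) (vc, false))
        (mid r);
      token (mid r) (nseq (residue r) (vb, false) ++ nseq (shift r) (vc, false)
                       ++ [:: (vd, false)]) (St (dst r))].

Definition tokens : seq (word nat) :=
  flatten [seq rule_tokens r | r <- R] ++
  [:: token (St final) [::] Drop;
      token Drop [:: (vc, true)] Drop;
      token Drop [::] Check;
      token Check [:: (vd, true); (va, true)] Check;
      token Check [:: (vc, true); (vb, true)] Check].

Definition query (N : nat) : word nat := token (St 0) (nseq N (vc, true)) Check.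

Notation yact := (act perm perm_inv).
Notation hact := (act store unstore).

(** ** Soundness *)

Definition data_word (W : word nat) := all (fun l => l.1 < 6) W.

Lemma data_word_cat U W : data_word (U ++ W) = data_word U && data_word W.
Proof. exact: all_cat. Qed.

Lemma data_word_nseq N k e : k < 6 -> data_word (nseq N (k, e)).
Proof. by move=> k6; rewrite /data_word all_nseq /= k6 orbT. Qed.

Lemma yact_data W h : data_word W -> yact W (h, None) = (hact W h, None).
Proof.
elim: W h => [|[k e] W IHW] h //= /andP[k6 dataW].
by case: e; rewrite /letter_act /= ?[perm _ _]/perm ?[perm_inv _ _]/perm_inv k6 /= IHW.
Qed.

Lemma yact_data_id W h z : data_word W -> yact W (h, Some z) = (h, Some z).
Proof.
elim: W => [|[k e] W IHW] //= /andP[k6 dataW].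
by case: e; rewrite /letter_act /= ?[perm _ _]/perm ?[perm_inv _ _]/perm_inv k6 /= IHW.
Qed.

Lemma perm_state p h z : perm (state_vertex p) (h, z) = (h, enter (state_vertex p) z).
Proof.
by rewrite /perm /state_vertex ltnNge leq_addl /= oddD odd_double.
Qed.

Lemma perm_inv_state p h z : perm_inv (state_vertex p) (h, z) = (h, leave (state_vertex p) z).
Proof.
by rewrite /perm_inv /state_vertex ltnNge leq_addl /= oddD odd_double.
Qed.

Lemma state_vertex_inj : injective state_vertex.
Proof. by move=> p q; rewrite /state_vertex => H; apply: state_code_inj; lia. Qed.

Section Stable.
Variable inv : state -> memory -> Prop.

(** From [Some (p, (false, 0))], a generator [s_p x s_q^-1] does [x] on the
    memory and moves to [Some (q, (false, 0))]. Any other generator fixes the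
    memory and the label [p], and changes at most the depth [t]; at a positive
    depth, no generator reaches the memory. So an excursion away from depth 0
    can only end where it began. *)
Definition stable (y : config) : Prop :=
  exists p t, y.2 = Some (state_vertex p, (false, t)) /\ inv p y.1.

Lemma token_stable p W q :
    data_word W -> (forall h, inv p h -> inv q (hact W h)) ->
  forall y, stable y -> stable (yact (token p W q) y).
Proof.
move=> dataW invW [h z] [p' [t /= [-> inv_h]]].
rewrite /= act_cat /= /letter_act /= perm_state /=.
case: eqP => [/state_vertex_inj E|/eqP p'p].
  rewrite {}E in inv_h *; case: t => [|t].
    rewrite yact_data // perm_inv_state /=.
    by exists q, 0; split=> //; apply: invW.
  rewrite yact_data_id // perm_inv_state /=; case: eqP => [E|_].
    by exists p, t.+1.
  by exists p, t.
rewrite yact_data_id // perm_inv_state /=; case: eqP => [E|_].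
  by exists p', t.+1.
by exists p', t.
Qed.
End Stable.

Variable start : nat.

(** In state [q], with [true] for [a, d] and [false] for [b, c], the run
    [(0, start) = (q_0, N_0), ..., (q, N)] has left the stacks
    [c^N a c^N' a ...] and [d b^N' d ...], top first. The second one is the
    first one without its topmost block exactly when every step has read what
    the previous one had written; the invariant records that in this case the
    run is genuine. The second stack is empty or starts with [d], so that the
    topmost block is well defined. *)
Definition block_inv (q : nat) (s t : seq bool) : Prop :=
  (forall N, s = nseq N false ++ t -> steps R (0, start) (q, N)) /\
  (if t is x :: _ then x else true).

Definition drop_inv (s t : seq bool) : Prop :=
  exists N, block_inv final (nseq N false ++ s) t.

(** In state [Check], the word [u] is what has been removed from both stacks. *)
Definition machine_inv (p : state) (h : memory) : Prop :=
  match p with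
  | St q => exists s t, h = (Good s, Good t) /\ block_inv q s t
  | Mid j => exists r k s t, [/\ r \in R, j = index r R, block_inv (src r) s t
      & h = (Good (nseq (factor r * k) false ++ true :: s),
             Good (nseq (modulus r * k) false ++ t))]
  | Drop => bad h.1 || bad h.2 \/
      exists s t, h = (Good s, Good t) /\ drop_inv s t
  | Check => bad h.1 || bad h.2 \/
      exists s t u, h = (Good s, Good t) /\ drop_inv (u ++ s) (u ++ t)
  end.

Lemma nseq_false_inj M N s t :
  nseq M false ++ true :: s = nseq N false ++ true :: t -> M = N /\ s = t.
Proof.
elim: M N => [|M IHM] [|N] //=; first by case.
by case=> /IHM[-> ->].
Qed.

Lemma hact_push_b N s t : hact (nseq N (vb, false)) (s, Good t) =
  (s, Good (nseq N false ++ t)).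
Proof.
rewrite act_nseq /letter_act /=; elim: N => // N IHN.
by rewrite iterS IHN.
Qed.

Lemma hact_push_c N s t : hact (nseq N (vc, false)) (Good s, t) =
  (Good (nseq N false ++ s), t).
Proof.
rewrite act_nseq /letter_act /=; elim: N => // N IHN.
by rewrite iterS IHN.
Qed.

Lemma tokens_stable W : W \in tokens ->
  forall y, stable machine_inv y -> stable machine_inv (yact W y).
Proof.
rewrite mem_cat => /orP[/flattenP[_ /mapP[r rR ->]]|].
  rewrite !inE => /or3P[] /eqP ->; apply: token_stable => //.
  - move=> _ [s [t [-> st_inv]]]; exists r, 0, s, t; split=> //.
    by rewrite !muln0.
  - by rewrite data_word_cat !data_word_nseq.
  - move=> _ [r' [k [s [t [r'R ir st_inv ->]]]]].
    have {ir} E : r = r'.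
      by rewrite -(nth_index r rR) -(nth_index r r'R) ir.
    rewrite -{}E {r' r'R} in st_inv *.
    exists r, k.+1, s, t; split=> //.
    by rewrite act_cat hact_push_b hact_push_c !catA -!nseqD !mulnS.
  - by rewrite !data_word_cat !data_word_nseq.
  - move=> _ [r' [k [s [t [r'R ir st_inv ->]]]]].
    have {ir} E : r = r'.
      by rewrite -(nth_index r rR) -(nth_index r r'R) ir.
    rewrite -{}E {r' r'R} in st_inv *.
    rewrite !act_cat hact_push_b hact_push_c !catA -!nseqD /=.
    do 2!eexists; split; first by [].
    (* The new second stack starts with [d]: comparing it with the first one
       determines the value just written and, below the letter [a], requires
       the value just read to be the one that the previous step had written. *)
    split=> // N /nseq_false_inj[<- Es].
    case: st_inv => reach _; rewrite addnC; rewrite addnC in Es.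
    exact: steps_step (reach _ Es) (Step k rR).
rewrite !inE => /or4P[|||/orP[]] /eqP ->; apply: token_stable => //.
- by move=> _ [s [t [-> st_inv]]]; right; exists s, t; split=> //; exists 0.
- move=> h [bad_h|[s [t [-> [N st_inv]]]]]; rewrite /= /letter_act /=.
    by left; case/orP: bad_h => [/(bad_pop false) ->|->]; rewrite ?orbT.
  case: s st_inv => [|[] s] st_inv; [by left|by left|right].
  exists s, t; split=> //; exists N.+1; rewrite -addn1 nseqD -catA //.
- by move=> h [bad_h|[s [t [-> st_inv]]]]; [left|right; exists s, t, [::]].
- move=> [h1 h2] [bad_h|[s [t [u [[-> ->] st_inv]]]]]; rewrite /= /letter_act /=.
    by left; case/orP: bad_h => /(bad_pop true) ->; rewrite ?orbT.
  case: s t st_inv => [|[] s] [|[] t] st_inv; do ?[by left].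
  by right; exists s, t, (rcons u true); rewrite !cat_rcons.
- move=> [h1 h2] [bad_h|[s [t [u [[-> ->] st_inv]]]]]; rewrite /= /letter_act /=.
    by left; case/orP: bad_h => /(bad_pop false) ->; rewrite ?orbT.
  case: s t st_inv => [|[] s] [|[] t] st_inv; do ?[by left].
  by right; exists s, t, (rcons u false); rewrite !cat_rcons.
Qed.

Lemma query_act :
  yact (query start) ((Good (nseq start false), Good [::]), Some (state_vertex (St 0), (false, 0)))
  = ((Good [::], Good [::]), Some (state_vertex Check, (false, 0))).
Proof.
have sm : data_word (nseq start (vc, true)) by apply: data_word_nseq.
rewrite /= act_cat /letter_act /= perm_state /= yact_data // /letter_act /= perm_inv_state act_nseq /letter_act /=.
have -> k s t : iter k (unstore vc) (s, t) = (iter k (pop false) s, t).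
  by elim: k => // k IHk; rewrite !iterS IHk.
by rewrite -[nseq _ _]cats0 iter_pop.
Qed.

Lemma stable_query :
    (forall y, stable machine_inv y -> stable machine_inv (yact (query start) y)) ->
  exists N, steps R (0, start) (final, N).
Proof.
move=> /(_ ((Good (nseq start false), Good [::]), Some (state_vertex (St 0), (false, 0)))).
rewrite query_act; case.
  exists (St 0), 0; split=> //; exists (nseq start false), [::]; split=> //.
  split=> // N; rewrite cats0 => /(congr1 size); rewrite !size_nseq => ->.
  exact: Steps0.
move=> p [t [/= [/state_vertex_inj <- _] [//|]]].
move=> [s [s' [u [[<- <-] [N [reach _]]]]]].
by exists N; apply: reach.
Qed.

End Machine.

(** ** Completeness *)

Section Reduction.
Local Open Scope group_scope.
Variables (m n : nat) (hm : 1 < m) (hn : 1 < n).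
Variables (R : seq affine_rule) (final : nat).

Let G := Gmn m n.

Definition path_val (U : word nat) : G := gval _ (expand m n U).

Lemma path_val_cat U W : path_val (U ++ W) = path_val U * path_val W.
Proof. by rewrite /path_val expand_cat gval_cat. Qed.

Definition vertex_val (k : nat) : G := path_val [:: (k, false)].

Lemma path_val_inv k : path_val [:: (k, true)] = (vertex_val k)^-1.
Proof. by rewrite /vertex_val /path_val /expand /= !cats0 gval_winv. Qed.

Lemma path_val_nseq N l : path_val (nseq N l) = path_val [:: l] ^+ N.
Proof. by elim: N => [|N IHN] //; rewrite expgS -IHN -path_val_cat. Qed.

Lemma vertex_val_commute k : commute (vertex_val k) (vertex_val k.+1).
Proof.
rewrite /vertex_val /path_val /expand /= !cats0; exact: vertex_word_commute.
Qed.

Notation a := (vertex_val va).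
Notation b := (vertex_val vb).
Notation c := (vertex_val vc).
Notation d := (vertex_val vd).

Definition guarded (p : state) (x : G) (q : state) : G :=
  vertex_val (state_vertex p) * x * (vertex_val (state_vertex q))^-1.

Lemma path_val_token p W q : path_val (token p W q) = guarded p (path_val W) q.
Proof.
rewrite /token -cat1s !path_val_cat path_val_inv mulgA; by [].
Qed.

Notation member :=
  (submonoid_gen [seq gval _ w | w <- map (expand m n) (tokens R final)]).

Lemma member_token p W q x :
  token p W q \in tokens R final -> path_val W = x -> member (guarded p x q).
Proof.
move=> tok <-; rewrite -path_val_token; apply: submonoid_mem.
by do 2!apply: map_f.
Qed.

Lemma member_mul p q r x y :
  member (guarded p x q) -> member (guarded q y r) -> member (guarded p (x * y) r).
Proof.
move=> px qy; have := submonoid_mul px qy.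
by rewrite /guarded !mulgA mulgVK.
Qed.

Lemma member_exp p x N : member (guarded p x p) -> member (guarded p (x ^+ N) p).
Proof.
move=> px; elim: N => [|N IHN]; last by rewrite expgS; apply: member_mul px IHN.
by rewrite expg0 /guarded mulg1 mulgV; apply: submonoid_one.
Qed.

(** One step of the machine, read backwards: a query for [c^-M] surrounded by
    the generators of a step from [N] to [M], and by those that undo it, is the
    query for [c^-N]. *)
Lemma step_identity N M :
  a * (b ^+ N * c ^+ M * d) * c ^- M * (d^-1 * a^-1) * (c^-1 * b^-1) ^+ N = c ^- N.
Proof.
have cd : commute (c ^+ M) d by apply/commute_sym/commuteX/vertex_val_commute.
have ba : commute (b ^+ N) a by apply/commute_sym/commuteX/commute_sym/vertex_val_commute.
have bc : commute c b by apply: vertex_val_commute.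
rewrite -(mulgA (b ^+ N)) cd !mulgA !mulgK -ba mulgK.
have -> : c^-1 * b^-1 = (c * b)^-1 by rewrite bc invgM.
by rewrite expVgn (expgMn _ bc) invgM mulVKg.
Qed.

Lemma member_complete q N N' :
  steps R (q, N) (final, N') -> member (guarded (St q) (c ^- N) Check).
Proof.
have last_tokens W : W \in
    [:: token (St final) [::] Drop; token Drop [:: (vc, true)] Drop;
        token Drop [::] Check; token Check [:: (vd, true); (va, true)] Check;
        token Check [:: (vc, true); (vb, true)] Check] ->
    W \in tokens R final by rewrite mem_cat orbC => ->.
move E: (q, N) => s; move F: (final, N') => t st.
elim: st q N E F => {s t} [_ q N <- [<- _]|_ _ e [r k rR] _ IH q N [-> ->] /IH{}IH].
  have -> : c ^- N = 1 * c^-1 ^+ N * 1 by rewrite mul1g mulg1 expVgn.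
  apply: (member_mul (q := Drop)); last first.
    by apply: (@member_token _ [::]) => //; apply: last_tokens; rewrite !inE eqxx ?orbT.
  apply: (member_mul (q := Drop)).
    by apply: (@member_token _ [::]) => //; apply: last_tokens; rewrite !inE eqxx.
  apply: member_exp; apply: (@member_token _ [:: (vc, true)]).
    by apply: last_tokens; rewrite !inE eqxx orbT.
  exact: path_val_inv.
have rule_tok W : W \in rule_tokens R r -> W \in tokens R final.
  move=> Wr; rewrite mem_cat; apply/orP; left.
  by apply/flattenP; exists (rule_tokens R r) => //; apply: map_f.
set M := factor r * k + shift r; set N0 := modulus r * k + residue r.
rewrite -(step_identity N0 M).
have bc : commute (b ^+ modulus r) (c ^+ factor r).
  by apply: commuteX2; apply/commute_sym/vertex_val_commute.
have cb : c ^+ (factor r * k) * b ^+ residue r = b ^+ residue r * c ^+ (factor r * k).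
  by apply: commuteX2; apply: vertex_val_commute.
have -> : b ^+ N0 * c ^+ M * d =
    (b ^+ modulus r * c ^+ factor r) ^+ k * (b ^+ residue r * (c ^+ shift r * d)).
  rewrite (expgMn _ bc) -!expgnA /N0 /M !expgnDr !mulgA; congr (_ * _ * _).
  by rewrite -!mulgA cb.
apply: (member_mul (q := Check)); last first.
  apply: member_exp.
  apply: (@member_token _ [:: (vc, true); (vb, true)]).
    by apply: last_tokens; rewrite !inE eqxx !orbT.
  by rewrite -cat1s path_val_cat !path_val_inv.
apply: (member_mul (q := Check)); last first.
  apply: (@member_token _ [:: (vd, true); (va, true)]).
    by apply: last_tokens; rewrite !inE eqxx !orbT.
  by rewrite -cat1s path_val_cat !path_val_inv.
apply: (member_mul (q := St (dst r))); last exact: IH.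
apply: (member_mul (q := mid R r)).
  by apply: (@member_token _ [:: (va, false)]) => //; apply: rule_tok; rewrite inE eqxx.
apply: (member_mul (q := mid R r)).
  apply: member_exp.
  apply: (@member_token _ (nseq (modulus r) (vb, false) ++ nseq (factor r) (vc, false))).
    by apply: rule_tok; rewrite !inE eqxx orbT.
  by rewrite path_val_cat !path_val_nseq.
apply: (@member_token _ (nseq (residue r) (vb, false) ++ nseq (shift r) (vc, false)
                         ++ [:: (vd, false)])).
  by apply: rule_tok; rewrite !inE eqxx !orbT.
by rewrite !path_val_cat !path_val_nseq.
Qed.

Lemma query_member N :
  member (path_val (query N)) <-> exists N', steps R (0, N) (final, N').
Proof.
split=> [memN|[N' /member_complete]]; last first.
  by rewrite /query path_val_token path_val_nseq path_val_inv expVgn.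
apply: stable_query => y; apply: (expand_submonoid permK perm_invK _ hm hn) memN _.
  exact: perm_commute.
exact: tokens_stable.
Qed.

End Reduction.

(** * Loop programs with registers *)

Definition env := nat -> nat.
Definition upd (s : env) (r v : nat) : env := fun j => if j == r then v else s j.

Inductive cmd :=
| Skip
| Inc of nat
| Seq of cmd & cmd
| Loop of nat & cmd.

Inductive exec : cmd -> env -> env -> Prop :=
| ExecSkip s : exec Skip s s
| ExecInc r s : exec (Inc r) s (upd s r (s r).+1)
| ExecSeq c d s t u : exec c s t -> exec d t u -> exec (Seq c d) s u
| ExecLoop0 r c s : s r = 0 -> exec (Loop r c) s s
| ExecLoopS r c s t u k : s r = k.+1 -> exec c (upd s r k) t ->
    exec (Loop r c) t u -> exec (Loop r c) s u.

(** ** Compilation to affine rules *)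

(** An environment of registers is stored in the counter as the product of the
    [reg_prime r ^ s r]. *)
Fixpoint reg_prime (r : nat) : nat :=
  if r is r'.+1 then s2val (prime_above (reg_prime r')) else 2.

Lemma reg_prime_prime r : prime (reg_prime r).
Proof. by case: r => [|r] //=; case: prime_above. Qed.

Lemma reg_prime_ltS r : reg_prime r < reg_prime r.+1.
Proof. by rewrite /=; case: prime_above. Qed.

Lemma reg_prime_inj : injective reg_prime.
Proof.
have lt_rp : {homo reg_prime : r s / r < s}.
  by apply: homo_ltn reg_prime_ltS; apply: ltn_trans.
move=> r s E; case: (ltngtP r s) => // /lt_rp; rewrite E ltnn //.
Qed.

Definition encodes (s : env) (N : nat) : Prop :=
  0 < N /\ forall r, logn (reg_prime r) N = s r.

Lemma encodes_inc s N r :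
  encodes s N -> encodes (upd s r (s r).+1) (reg_prime r * N).
Proof.
case=> N_gt0 sN; have p_gt0 := prime_gt0 (reg_prime_prime r).
split=> [|j]; first by rewrite muln_gt0 p_gt0.
rewrite lognM // logn_prime ?reg_prime_prime // sN /upd (inj_eq reg_prime_inj).
by case: eqP => [->|].
Qed.

Lemma encodes_dec s N r k : encodes s N -> s r = k.+1 ->
  exists2 M, N = reg_prime r * M & encodes (upd s r k) M.
Proof.
move=> [N_gt0 sN] srk; have p_pr := reg_prime_prime r.
have : reg_prime r %| N by rewrite -(expn1 (reg_prime r)) pfactor_dvdn // sN srk.
case/dvdnP=> M NM; exists M; first by rewrite mulnC.
have M_gt0 : 0 < M by move: N_gt0; rewrite NM; case: M {NM}.
split=> // j; move: (sN j); rewrite NM (lognM _ M_gt0 (prime_gt0 p_pr)).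
rewrite (logn_prime _ p_pr) (inj_eq reg_prime_inj) /upd.
case: eqP => [->|_] /=; last by rewrite addn0.
by rewrite srk addn1 => -[].
Qed.

Lemma encodes0 s N r : encodes s N -> s r = 0 -> 0 < N %% reg_prime r.
Proof.
move=> [N_gt0 sN] sr0; rewrite lt0n; apply/negP => /eqP pN.
have : reg_prime r %| N by rewrite /dvdn pN.
by rewrite -(expn1 (reg_prime r)) pfactor_dvdn ?reg_prime_prime // sN sr0.
Qed.

(** The counter is not a multiple of the prime: one rule per nonzero residue. *)
Definition zero_test (l r e : nat) : seq affine_rule :=
  [seq AffineRule l (reg_prime r) (reg_prime r) i i e
     | i <- iota 1 (reg_prime r).-1].

Definition branch (l r e' e : nat) : seq affine_rule :=
  AffineRule l (reg_prime r) 1 0 0 e' :: zero_test l r e.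

Fixpoint len (c : cmd) : nat :=
  match c with
  | Skip | Inc _ => 1
  | Seq c d => len c + len d
  | Loop _ c => (len c).+1
  end.

(** The rules of [c] with entry state [l] and exit state [e]; their source
    states are [l, ..., l + len c - 1]. *)
Fixpoint compile (c : cmd) (l e : nat) : seq affine_rule :=
  match c with
  | Skip => [:: AffineRule l 1 1 0 0 e]
  | Inc r => [:: AffineRule l 1 (reg_prime r) 0 0 e]
  | Seq c d => compile c l (l + len c) ++ compile d (l + len c) e
  | Loop r c => branch l r l.+1 e ++ compile c l.+1 l
  end.

Lemma step_rule R r k N M : r \in R ->
  N = modulus r * k + residue r -> M = factor r * k + shift r ->
  step R (src r, N) (dst r, M).
Proof. by move=> rR -> ->; apply: Step. Qed.

Lemma zero_test_step R l r e s N : {subset zero_test l r e <= R} ->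
  encodes s N -> s r = 0 -> step R (l, N) (e, N).
Proof.
move=> sub sN /(encodes0 sN) N_mod.
have p_gt0 := prime_gt0 (reg_prime_prime r).
pose i := N %% reg_prime r; pose q := AffineRule l (reg_prime r) (reg_prime r) i i e.
apply: (@step_rule R q (N %/ reg_prime r)); rewrite /= ?[reg_prime r * _]mulnC -?divn_eq //.
apply/sub/map_f; rewrite mem_iota N_mod add1n prednK // ltn_mod //.
Qed.

Lemma compile_steps R c s t : exec c s t ->
  forall l e N, {subset compile c l e <= R} -> encodes s N ->
  exists2 M, encodes t M & steps R (l, N) (e, M).
Proof.
elim=> {c s t} [s|r s|c d s t u _ IHc _ IHd|r c s sr0|r c s t u k srk _ IHc _ IHl] l e N sub sN.
- exists N => //; apply: StepsS (Steps0 _ _).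
  by apply: (@step_rule _ (AffineRule l 1 1 0 0 e) N) => /=; rewrite ?sub ?inE ?mul1n ?addn0.
- exists (reg_prime r * N); first exact: encodes_inc.
  apply: StepsS (Steps0 _ _).
  by apply: (@step_rule _ (AffineRule l 1 (reg_prime r) 0 0 e) N) => /=;
    rewrite ?sub ?inE ?mul1n ?addn0.
- case: (IHc l (l + len c) N) => [q qc||M tM NM] //.
    by apply: sub; rewrite mem_cat qc.
  case: (IHd (l + len c) e M) => [q qd||P uP MP] //.
    by apply: sub; rewrite mem_cat qd orbT.
  by exists P => //; apply: steps_trans NM MP.
- exists N => //; apply: StepsS (Steps0 _ _).
  by apply: zero_test_step sN sr0 => q qz; apply: sub; rewrite mem_cat inE qz orbT.
- have [M NM sM] := encodes_dec sN srk.
  case: (IHc l.+1 l M) => [q qc||P tP MP] //.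
    by apply: sub; rewrite mem_cat qc orbT.
  case: (IHl l e P) => // Q uQ PQ; exists Q => //.
  apply: StepsS (steps_trans MP PQ).
  apply: (@step_rule _ (AffineRule l (reg_prime r) 1 0 0 l.+1) M) => /=.
  + by apply: sub; rewrite mem_cat inE eqxx.
  + by rewrite addn0.
  by rewrite mul1n addn0.
Qed.

(** ** Determinism *)

Definition deterministic (R : seq affine_rule) : Prop :=
  forall c d e, step R c d -> step R c e -> d = e.

Definition sources (R : seq affine_rule) := [seq src r | r <- R].

Lemma step_source R q N d : step R (q, N) d -> q \in sources R.
Proof.
move E: (q, N) => c st; case: st E => r k rR [-> _]; exact: map_f.
Qed.

Lemma deterministic_cat R1 R2 : deterministic R1 -> deterministic R2 ->
  (forall q, q \in sources R1 -> q \in sources R2 -> False) ->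
  deterministic (R1 ++ R2).
Proof.
move=> det1 det2 dis.
have split_step c d : step (R1 ++ R2) c d -> step R1 c d \/ step R2 c d.
  by case=> r k; rewrite mem_cat => /orP[] rR; [left|right]; apply: Step.
move=> [q N] d e /split_step[] cd /split_step[] ce.
- exact: det1 cd ce.
- by case: (dis q); [apply: step_source cd|apply: step_source ce].
- by case: (dis q); [apply: step_source ce|apply: step_source cd].
- exact: det2 cd ce.
Qed.

Lemma deterministic1 r : 0 < modulus r -> deterministic [:: r].
Proof.
move=> p_gt0 c d e [r1 k]; rewrite inE => /eqP -> {r1} H.
move E: (_, _) H => c' H; case: H E => r1 k'; rewrite inE => /eqP -> [].
by move/eqP; rewrite eqn_add2r eqn_pmul2l // => /eqP ->.
Qed.

Lemma zero_test_step_inv l r e c d : step (zero_test l r e) c d ->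
  [/\ c.1 = l, d = (e, c.2) & ~~ (reg_prime r %| c.2)].
Proof.
case=> q k /mapP[i]; rewrite mem_iota add1n => /andP[i_gt0].
rewrite prednK ?prime_gt0 ?reg_prime_prime // => lt_i -> /=; split=> //.
by rewrite dvdn_addr ?dvdn_mulr // gtnNdvd.
Qed.

Lemma deterministic_zero_test l r e : deterministic (zero_test l r e).
Proof. by move=> c d d' /zero_test_step_inv[_ -> _] /zero_test_step_inv[_ -> _]. Qed.

Lemma deterministic_branch l r e e' :
  deterministic (branch l r e' e).
Proof.
have split_step c d : step (branch l r e' e) c d ->
    step [:: AffineRule l (reg_prime r) 1 0 0 e'] c d \/ step (zero_test l r e) c d.
  by case=> q k; rewrite inE => /orP[] qR; [left|right]; apply: Step; rewrite ?inE.
have div c d : step [:: AffineRule l (reg_prime r) 1 0 0 e'] c d -> reg_prime r %| c.2.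
  by case=> q k; rewrite inE => /eqP -> /=; rewrite addn0 dvdn_mulr.
move=> c d d' /split_step[] cd /split_step[] cd'.
- by apply: deterministic1 cd cd'; apply/prime_gt0/reg_prime_prime.
- by have [_ _ /negP[]] := zero_test_step_inv cd'; apply: div cd.
- by have [_ _ /negP[]] := zero_test_step_inv cd; apply: div cd'.
- exact: deterministic_zero_test cd cd'.
Qed.

Lemma sources_zero_test l r e q : q \in sources (zero_test l r e) -> q = l.
Proof. by case/mapP=> _ /mapP[i _ ->] ->. Qed.

Lemma sources_branch l r e' e q : q \in sources (branch l r e' e) -> q = l.
Proof. by rewrite inE => /orP[/eqP|/sources_zero_test]. Qed.

Lemma sources_compile c l e q : q \in sources (compile c l e) -> l <= q < l + len c.
Proof.
elim: c l e => [|r|c IHc d IHd|r c IHc] l e.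
- by rewrite inE => /eqP -> /=; rewrite addn1 leqnn ltnS leqnn.
- by rewrite inE => /eqP -> /=; rewrite addn1 leqnn ltnS leqnn.
- by rewrite /sources map_cat mem_cat => /orP[/IHc|/IHd] /=; lia.
- by rewrite /sources map_cat mem_cat => /orP[/sources_branch ->|/IHc] /=; lia.
Qed.

Lemma deterministic_compile c l e : deterministic (compile c l e).
Proof.
elim: c l e => [|r|c IHc d IHd|r c IHc] l e.
- exact: deterministic1.
- by apply: deterministic1.
- apply: deterministic_cat => // q /sources_compile qc /sources_compile qd; lia.
- apply: deterministic_cat => [||q]; [exact: deterministic_branch|exact: IHc|].
  by move=> /sources_branch -> /sources_compile; lia.
Qed.

Lemma steps_inv R c e : steps R c e ->
  c = e \/ exists2 d, step R c d & steps R d e.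
Proof. by case=> [|b d f bd df]; [left|right; exists d]. Qed.

(** A deterministic machine that gets stuck visits nothing after the state
    where it is stuck. *)
Lemma deterministic_steps R c d e : deterministic R ->
  (forall d', ~ step R d d') -> steps R c d -> steps R c e -> steps R e d.
Proof.
move=> det + cd; elim: cd e => {c d} [c|b c d bc cd IH] e stuck.
  by case/steps_inv=> [<-|[d /stuck]] //; apply: Steps0.
case/steps_inv=> [<-|[c' bc' c'e]]; first exact: StepsS bc cd.
by apply: IH => //; rewrite (det _ _ _ bc bc').
Qed.

(** ** Deciding a value by reaching a state *)

Definition input_env (x : nat) : env := fun r => if r == 0 then x else 0.

Lemma encodes_input x : encodes (input_env x) (2 ^ x).
Proof.
split=> [|r]; first by rewrite expn_gt0.
have E : logn (reg_prime r) (reg_prime 0) = (r == 0).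
  by rewrite (logn_prime _ (reg_prime_prime 0)) (inj_eq reg_prime_inj).
by rewrite lognX [logn _ 2]E /input_env; case: eqP; rewrite ?muln1 ?muln0.
Qed.

(** The only rules leaving the exit state of [c] test whether the output
    register 1 is zero: with a nonzero output, the machine is stuck there. *)
Definition zero_machine (c : cmd) : seq affine_rule :=
  compile c 0 (len c) ++ zero_test (len c) 1 (len c).+1.

Lemma zero_machineP c x t : exec c (input_env x) t ->
  (exists N, steps (zero_machine c) (0, 2 ^ x) ((len c).+1, N)) <-> t 1 = 0.
Proof.
move=> ex; set R := zero_machine c.
have sub1 : {subset compile c 0 (len c) <= R}.
  by move=> q qc; rewrite mem_cat qc.
have sub2 : {subset zero_test (len c) 1 (len c).+1 <= R}.
  by move=> q qz; rewrite mem_cat qz orbT.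
have det : deterministic R.
  apply: deterministic_cat.
  - exact: deterministic_compile.
  - exact: deterministic_zero_test.
  by move=> q /sources_compile qc /sources_zero_test qz; lia.
have [M tM xM] := compile_steps ex sub1 (encodes_input x).
split=> [[N xN]|t1]; last first.
  by exists M; apply: steps_step xM _; apply: zero_test_step sub2 tM t1.
have split_step d d' : step R d d' ->
    step (compile c 0 (len c)) d d' \/ step (zero_test (len c) 1 (len c).+1) d d'.
  by case=> r k; rewrite mem_cat => /orP[] rR; [left|right]; apply: Step.
apply/eqP/negPn/negP; rewrite -lt0n => t1.
have stuck d : ~ step R (len c, M) d.
  case/split_step=> [/step_source/sources_compile|/zero_test_step_inv[_ _]]; first lia.
  have [M_gt0 tM1] := tM.
  by rewrite -[reg_prime 1]expn1 pfactor_dvdn ?reg_prime_prime // tM1 t1.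
have /steps_inv[[/eqP]|[d /split_step[]]] := deterministic_steps det stuck xM xN.
- by rewrite eqn_leq ltnn.
- by move/step_source/sources_compile; lia.
- by case/zero_test_step_inv=> /= /eqP; rewrite eqn_leq ltnn.
Qed.

(** * Loop programs for recursive functions *)

Definition clear r := Loop r Skip.
Definition move_to r o := Loop r (Inc o).
Definition copy_to a o t := Seq (Loop a (Seq (Inc o) (Inc t))) (move_to t a).
Definition seqs (l : seq cmd) := foldr Seq Skip l.

(** Registers of [RPrim], from [K] on: accumulator, index, number of remaining
    rounds, new value. Registers of [RMu]: candidate, value at the candidate. *)
Fixpoint program n (f : recfun n) (args : seq nat) (o K : nat) : cmd :=
  match f with
  | RZero _ => Skip
  | RSucc => Seq (copy_to (head 0 args) o K) (Inc o)
  | RProj _ i => copy_to (nth 0 args i) o K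
  | RComp k _ f g =>
    Seq (seqs [seq program (g i) args (K + i) (K + k) | i <- enum 'I_k])
   (Seq (program f (iota K k) o (K + k))
        (seqs [seq clear r | r <- iota K k]))
  | RPrim _ f g =>
    Seq (copy_to (head 0 args) (K + 2) (K + 3))
   (Seq (program f (behead args) K (K + 4))
   (Seq (Loop (K + 2)
          (Seq (program g [:: K + 1, K & behead args] (K + 3) (K + 4))
          (Seq (clear K)
          (Seq (move_to (K + 3) K)
               (Inc (K + 1))))))
   (Seq (clear (K + 1))
        (move_to K o))))
  | RMu _ f =>
    let body := program f (K :: args) (K + 1) (K + 2) in
    Seq body
   (Seq (Loop (K + 1) (Seq (clear (K + 1)) (Seq (Inc K) body)))
        (move_to K o))
  end.

Ltac upd_ext := apply: funext => j; rewrite /upd; repeat (case: eqP => ? //=); subst; lia.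

Lemma exec_eq c s t t' : exec c s t -> t = t' -> exec c s t'.
Proof. by move=> + <-. Qed.

Lemma exec_clear r s : exec (clear r) s (upd s r 0).
Proof.
move E: (s r) => k; elim: k s E => [|k IHk] s E.
  by apply: exec_eq (ExecLoop0 _ E) _; upd_ext.
apply: exec_eq (ExecLoopS E (ExecSkip _) (IHk _ _)) _; last by upd_ext.
by rewrite /upd eqxx.
Qed.

Lemma exec_move r o s : r != o ->
  exec (move_to r o) s (upd (upd s o (s o + s r)) r 0).
Proof.
move=> /eqP ro; move E: (s r) => k; elim: k s E => [|k IHk] s E.
  by apply: exec_eq (ExecLoop0 _ E) _; upd_ext.
apply: exec_eq (ExecLoopS E (ExecInc _ _) (IHk _ _)) _; last by upd_ext.
by rewrite /upd; do 2!case: eqP => //; lia.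
Qed.

Lemma exec_copy a o t s : a != o -> a != t -> o != t -> s t = 0 ->
  exec (copy_to a o t) s (upd s o (s o + s a)).
Proof.
move=> /eqP ao /eqP aT /eqP ot st.
have loop k s' : s' a = k -> exec (Loop a (Seq (Inc o) (Inc t))) s'
    (upd (upd (upd s' o (s' o + k)) t (s' t + k)) a 0).
  elim: k s' => [|k IHk] s' E; first by apply: exec_eq (ExecLoop0 _ E) _; upd_ext.
  apply: exec_eq (ExecLoopS E (ExecSeq (ExecInc _ _) (ExecInc _ _)) (IHk _ _)) _.
    by rewrite /upd; repeat (case: eqP => ? //=); lia.
  by upd_ext.
apply: exec_eq (ExecSeq (loop _ _ (erefl _)) (exec_move _ _)) _.
  by rewrite eq_sym; apply/eqP.
by upd_ext.
Qed.

Lemma exec_clears l s :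
  exec (seqs [seq clear r | r <- l]) s (fun r => if r \in l then 0 else s r).
Proof.
elim: l s => [|r l IHl] s /=; first exact: ExecSkip.
apply: exec_eq (ExecSeq (exec_clear r s) (IHl _)) _.
by apply: funext => j; rewrite inE /upd; case: eqP => //= _; case: ifP.
Qed.

(** The program of [f] reads its arguments in [args], adds the value to the
    empty register [o], and restores the scratch registers, from [K] on. *)
Definition computes n (f : recfun n) : Prop :=
  forall args o K s (v : n.-tuple nat) y,
    [seq s r | r <- args] = v -> all (ltn^~ K) args -> o < K -> o \notin args ->
    s o = 0 -> (forall r, K <= r -> s r = 0) -> rec_eval f v y ->
  exec (program f args o K) s (upd s o y).

Lemma map_upd s r v (l : seq nat) : r \notin l ->
  [seq upd s r v j | j <- l] = [seq s j | j <- l].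
Proof.
move=> rl; apply/eq_in_map => j jl; rewrite /upd; case: eqP => // E.
by rewrite -E jl in rl.
Qed.

Lemma notin_fresh K (args : seq nat) r : all (ltn^~ K) args -> K <= r -> r \notin args.
Proof.
by move=> /allP lt_args Kr; apply/negP => /lt_args /=; rewrite ltnNge Kr.
Qed.

(** During the evaluation of the [g i], the scratch register [K + i] holds the
    [i]-th value once it is known; this is the environment [st j] below. *)
Lemma computes_comp k n (f : recfun k) (g : 'I_k -> recfun n) :
  computes f -> (forall i, computes (g i)) -> computes (RComp f g).
Proof.
move=> cf cg args o K s v y sv lt_args oK o_args so sK [w gw fw].
pose st j : env := fun r => if (K <= r) && (r < K + j) then nth 0 w (r - K) else s r.
have st_args j : [seq st j r | r <- args] = v.
  rewrite -sv; apply/eq_in_map => r /(allP lt_args) /= rK.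
  by rewrite /st leqNgt rK.
have all_g (l : seq 'I_k) j : map val l = iota j (size l) ->
    exec (seqs [seq program (g i) args (K + i) (K + k) | i <- l]) (st j) (st (j + size l)).
  elim: l j => [|i l IHl] j /=; first by rewrite addn0; constructor.
  case=> ij /IHl; rewrite addSnnS => execl; apply: ExecSeq execl.
  have <- : upd (st j) (K + i) (tnth w i) = st j.+1.
    apply: funext => r; rewrite /upd /st -ij (tnth_nth 0).
    case: eqP => [->|ri]; first by rewrite leq_addr addnS leqnn addnC addnK.
    by rewrite addnS ltnS [r <= _]leq_eqVlt (introF eqP ri).
  apply: (cg i args _ _ _ v _ _ _ _ _ _ _ (gw i)) => //.
  - by apply/allP => r /(allP lt_args) /=; lia.
  - by rewrite ltn_add2l.
  - by apply: notin_fresh lt_args _; apply: leq_addr.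
  - by rewrite /st -ij ltnn andbF sK // leq_addr.
  by move=> r Kr; rewrite /st -ij; case: ifP => [|_]; [have := ltn_ord i; lia|apply: sK; lia].
have st0 : st 0 = s.
  by apply: funext => r; rewrite /st addn0; case: ifP => //; lia.
have := all_g (enum 'I_k) 0; rewrite val_enum_ord size_enum_ord st0 => /(_ erefl) exec_g.
apply: ExecSeq exec_g _.
apply: ExecSeq (cf (iota K k) o (K + k) (st k) w y _ _ _ _ _ _ fw) _.
- rewrite -{1}[K]addn0 iotaDl -map_comp; apply: (@eq_from_nth _ 0).
    by rewrite size_map size_iota size_tuple.
  rewrite size_map size_iota => i ik.
  by rewrite (nth_map 0) ?size_iota // nth_iota //= /st leq_addr ltn_add2l ik addKn.
- by apply/allP => r; rewrite mem_iota => /andP[].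
- lia.
- by rewrite mem_iota leqNgt oK.
- by rewrite /st leqNgt oK.
- by move=> r Kr; rewrite /st ltnNge Kr andbF sK //; lia.
apply: exec_eq (exec_clears _ _) _.
apply: funext => r; rewrite mem_iota /upd /st.
case: ifP => Kr; last by rewrite Kr.
by case: eqP => [?|_]; [lia|rewrite sK //; lia].
Qed.

Lemma computes_prim n (f : recfun n) (g : recfun n.+2) :
  computes f -> computes g -> computes (RPrim f g).
Proof.
move=> cf cg [|a args] o K s v y; first by case/tupleP: v.
move=> sv lt_args oK o_args so sK [h [h0 hS ->]].
set x := thead v in hS *.
have [sa s_args] : s a = x /\ [seq s r | r <- args] = behead v.
  by rewrite /x; case/tupleP: v sv {x h0 hS} => u v [<- sv]; rewrite theadE.
case/andP: lt_args => /= aK lt_args; move: o_args; rewrite inE negb_or => /andP[oa o_args].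
pose st i : env := upd (upd (upd s K (h i)) (K + 1) i) (K + 2) (x - i).
have sm r z s' : K <= r -> [seq s' j | j <- args] = behead v ->
    [seq upd s' r z j | j <- args] = behead v.
  by move=> Kr <-; rewrite map_upd // (notin_fresh lt_args).
have lt4 : all (ltn^~ (K + 4)) args by apply/allP => r /(allP lt_args) /=; lia.
have body i : i < x -> exec
    (Seq (program g [:: K + 1, K & args] (K + 3) (K + 4))
    (Seq (clear K) (Seq (move_to (K + 3) K) (Inc (K + 1)))))
    (upd (st i) (K + 2) (x - i.+1)) (st i.+1).
  move=> ix; set s1 := upd (st i) _ _.
  have ex : exec (program g [:: K + 1, K & args] (K + 3) (K + 4)) s1
      (upd s1 (K + 3) (h i.+1)).
    apply: cg (hS i ix) => //=.
    - congr [:: _, _ & _]; rewrite ?/s1 ?/st; do ?[by rewrite /upd; repeat (case: eqP => ? //=); lia].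
      by do 4?[apply: (sm); first by lia].
    - by rewrite lt4 andbT; lia.
    - lia.
    - rewrite !inE !negb_or (notin_fresh lt_args) ?leq_addr // andbT; lia.
    - by rewrite /s1 /st /upd; repeat (case: eqP => ? //=); try lia; apply: sK; lia.
    by move=> r Kr; rewrite /s1 /st /upd; repeat (case: eqP => ? //=); try lia; apply: sK; lia.
  apply: ExecSeq ex _; apply: ExecSeq (exec_clear _ _) _.
  apply: ExecSeq (exec_move _ _) _; first lia.
  apply: exec_eq (ExecInc _ _) _.
  have s3 : s (K + 3) = 0 by apply: sK; lia.
  by rewrite /s1 /st; upd_ext.
have loop d i : i + d = x -> exec (Loop (K + 2)
    (Seq (program g [:: K + 1, K & args] (K + 3) (K + 4))
    (Seq (clear K) (Seq (move_to (K + 3) K) (Inc (K + 1)))))) (st i) (st x).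
  elim: d i => [|d IHd] i E.
    by rewrite -E addn0; apply: ExecLoop0; rewrite /st /upd eqxx -E; lia.
  apply: (@ExecLoopS _ _ _ (st i.+1) _ (x - i.+1)); last by apply: IHd; lia.
    by rewrite /st /upd eqxx; lia.
  by apply: body; lia.
have [sK0 sK1 sK2] : [/\ s K = 0, s (K + 1) = 0 & s (K + 2) = 0].
  by split; apply: sK; lia.
have ex_copy : exec (copy_to a (K + 2) (K + 3)) s (upd s (K + 2) (s (K + 2) + s a)).
  by apply: exec_copy; [lia|lia|lia|apply: sK; lia].
apply: ExecSeq ex_copy _.
apply: ExecSeq (cf args K (K + 4) _ [tuple of behead v] (h 0) _ _ _ _ _ _ h0) _ => //=.
- by apply: (sm) s_args; lia.
- lia.
- by apply: notin_fresh lt_args _.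
- by rewrite /upd; case: eqP => // ?; lia.
- by move=> r Kr; rewrite /upd; case: eqP => ?; [lia|apply: sK; lia].
rewrite sa sK2 add0n.
have -> : upd (upd s (K + 2) x) K (h 0) = st 0.
  by rewrite /st subn0; upd_ext.
apply: ExecSeq (loop x 0 (add0n x)) _; apply: ExecSeq (exec_clear _ _) _.
apply: exec_eq (exec_move _ _) _; first lia.
by rewrite /st subnn; upd_ext.
Qed.

Lemma computes_mu n (f : recfun n.+1) : computes f -> computes (RMu f).
Proof.
move=> cf args o K s v y sv lt_args oK o_args so sK [fy f_lt].
pose st i z : env := upd (upd s K i) (K + 1) z.
have lt2 : all (ltn^~ (K + 2)) args by apply/allP => r /(allP lt_args) /=; lia.
have [sK0 sK1] : s K = 0 /\ s (K + 1) = 0 by split; apply: sK; lia.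
have run i z : rec_eval f [tuple of i :: v] z ->
    exec (program f (K :: args) (K + 1) (K + 2)) (upd s K i) (st i z).
  move=> fi; apply: (cf _ _ _ _ [tuple of i :: v]) => //=.
  - rewrite {1}/upd eqxx; congr (_ :: _).
    by rewrite map_upd // (notin_fresh lt_args).
  - by rewrite lt2 andbT; lia.
  - lia.
  - rewrite inE negb_or (notin_fresh lt_args) ?leq_addr // andbT; lia.
  - by rewrite /upd; case: eqP => // ?; lia.
  by move=> r Kr; rewrite /upd; case: eqP => ?; [lia|apply: sK; lia].
have loop d i z : i + d = y -> rec_eval f [tuple of i :: v] z ->
    (i < y -> 0 < z) -> (i = y -> z = 0) ->
  exec (Loop (K + 1) (Seq (clear (K + 1)) (Seq (Inc K)
     (program f (K :: args) (K + 1) (K + 2))))) (st i z) (st y 0).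
  elim: d i z => [|d IHd] i z E fi z_gt0 z0.
    have {}E : i = y by lia.
    by rewrite z0 // E; apply: ExecLoop0; rewrite /st /upd eqxx.
  have {z_gt0} : 0 < z by apply: z_gt0; lia.
  case: z fi z0 => // z fi z0 _.
  have [z' [fz' z'_gt0 z'0]] : exists z', [/\ rec_eval f [tuple of i.+1 :: v] z',
      (i.+1 < y -> 0 < z') & (i.+1 = y -> z' = 0)].
    case: (ltngtP i.+1 y) => iy; [|lia|].
      by have [z' fz'] := f_lt _ iy; exists z'.+1; split=> //; lia.
    by exists 0; rewrite iy; split=> //; lia.
  apply: (@ExecLoopS _ _ _ (st i.+1 z') _ z); first by rewrite /st /upd eqxx.
    apply: ExecSeq (exec_clear _ _) _; apply: ExecSeq (ExecInc _ _) _.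
    set s' := upd _ K _; suff -> : s' = upd s K i.+1 by apply: run.
    by rewrite /s' /st; upd_ext.
  by apply: IHd => //; lia.
have [z [fz z_gt0 z0]] : exists z, [/\ rec_eval f [tuple of 0 :: v] z,
    (0 < y -> 0 < z) & (0 = y -> z = 0)].
  case: (ltngtP 0 y) => y0; [|lia|].
    by have [z fz] := f_lt _ y0; exists z.+1; split=> //; lia.
  by exists 0; rewrite -y0 in fy *; split.
have s_K : upd s K 0 = s by upd_ext.
have := run 0 z fz; rewrite s_K => exec0.
apply: ExecSeq exec0 _; apply: ExecSeq (loop y 0 z (add0n y) fz z_gt0 z0) _.
apply: exec_eq (exec_move _ _) _; first lia.
by rewrite /st; upd_ext.
Qed.

Lemma computesP n (f : recfun n) : computes f.
Proof.
elim: n / f => [n||n i|k n f cf g cg|n f cf g cg|n f cf].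
- move=> args o K s v y sv lt_args oK o_args so sK ->.
  by apply: exec_eq (ExecSkip _) _; upd_ext.
- move=> args o K s v y sv lt_args oK o_args so sK ->.
  case: args sv lt_args o_args => [|a args]; first by case/tupleP: v.
  move=> sv /= /andP[aK _]; rewrite inE negb_or => /andP[oa _].
  have sa : s a = thead v by case/tupleP: v sv => u v [<- _]; rewrite theadE.
  apply: ExecSeq (exec_copy _ _ _ _) _; [lia|lia|lia|exact: sK|].
  by apply: exec_eq (ExecInc _ _) _; upd_ext.
- move=> args o K s v y sv lt_args oK o_args so sK ->.
  have size_args : size args = n by rewrite -(size_map s) sv size_tuple.
  have i_args : nth 0 args i \in args by rewrite mem_nth // size_args.
  have aK := allP lt_args _ i_args; rewrite /= in aK.
  have si : s (nth 0 args i) = tnth v i.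
    by rewrite (tnth_nth 0) -sv (nth_map 0) // size_args.
  have oa : o != nth 0 args i by apply: contraNneq o_args => ->.
  apply: exec_eq (exec_copy _ _ _ _) _; [lia|lia|lia|exact: sK|].
  by rewrite si so add0n.
- exact: computes_comp.
- exact: computes_prim.
- exact: computes_mu.
Qed.

(** At an argument where [f] is defined, the program terminates, so that
    determinism spares the analysis of arbitrary runs. *)
Lemma zero_machine_rec (f : recfun 1) : exists R final,
  forall x y, rec_eval f [tuple x] y ->
    (exists N, steps R (0, 2 ^ x) (final, N)) <-> y = 0.
Proof.
pose c := program f [:: 0] 1 2.
exists (zero_machine c), (len c).+1 => x y fxy.
have ex : exec c (input_env x) (upd (input_env x) 1 y).
  by apply: (computesP _ _ _ _ _ _ fxy) => //= r; case: r.
by rewrite (zero_machineP ex) /upd eqxx.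
Qed.

(** * Recursive functions computing the codes of instances *)

Definition rec1 (F : nat -> nat) : Prop :=
  exists f : recfun 1, forall x, rec_eval f [tuple x] (F x).

Definition rec2 (F : nat -> nat -> nat) : Prop :=
  exists f : recfun 2, forall x y, rec_eval f [tuple x; y] (F x y).

Lemma rec1_comp F G : rec1 F -> rec1 G -> rec1 (fun x => F (G x)).
Proof.
case=> f fF [g gG]; exists (RComp f (fun _ : 'I_1 => g)) => x.
by exists [tuple G x] => // i; rewrite (tnth_nth 0) ord1.
Qed.

Lemma rec1_comp2 F G H : rec2 F -> rec1 G -> rec1 H -> rec1 (fun x => F (G x) (H x)).
Proof.
case=> f fF [g gG] [h hH].
exists (RComp f (fun i : 'I_2 => if val i == 0 then g else h)) => x.
by exists [tuple G x; H x] => // -[[|[|i]] lt_i]; rewrite (tnth_nth 0) //=.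
Qed.

Lemma rec1_id : rec1 id.
Proof. by exists (RProj ord0) => x; rewrite /= (tnth_nth 0). Qed.

Lemma rec1_succ : rec1 S.
Proof. by exists RSucc => x. Qed.

Lemma rec1_const c : rec1 (fun=> c).
Proof.
elim: c => [|c IHc]; first by exists (RZero 1).
exact: rec1_comp rec1_succ IHc.
Qed.

Lemma rec2_iter F : rec1 F -> rec2 (fun k x => iter k F x).
Proof.
case=> f fF.
exists (RPrim (RProj (ord0 : 'I_1)) (RComp f (fun _ : 'I_1 => RProj (inord 1 : 'I_3)))) => k x.
exists (fun i => iter i F x); split=> // i _.
exists [tuple iter i F x] => // j.
by rewrite (tnth_nth 0) ord1 /= (tnth_nth 0) /= inordK.
Qed.

Lemma rec1_double : rec1 double.
Proof.
have [f fP] : rec1 (fun x => iter x (fun y => y.+2) 0).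
  apply: (@rec1_comp2 (fun k x => iter k _ x) id (fun=> 0)).
  - exact: rec2_iter (rec1_comp rec1_succ rec1_succ).
  - exact: rec1_id.
  - exact: rec1_const.
exists f => x; have -> // : x.*2 = iter x (fun y => y.+2) 0.
by elim: x => // x IHx; rewrite doubleS IHx.
Qed.

Lemma iter_double k x : iter k double x = 2 ^ k * x.
Proof. by elim: k => [|k IHk]; rewrite ?mul1n // iterS IHk expnS -mulnA mul2n. Qed.

Lemma rec2_scale : rec2 (fun k x => 2 ^ k * x).
Proof.
have [f fP] := rec2_iter rec1_double.
by exists f => k x; rewrite -iter_double.
Qed.

Lemma rec1_exp2 : rec1 (expn 2).
Proof.
have [f fP] := rec1_comp2 rec2_scale rec1_id (rec1_const 1).
by exists f => x; rewrite -[2 ^ x]muln1.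
Qed.

(** ** Codes of words *)

Definition code_letter (l : bool * bool) (z : nat) : nat := 2 ^ pickle l * z.*2.+1.

Lemma pickle_word (w : word bool) : pickle w = foldr code_letter 0 w.
Proof. by elim: w => // l w IHw; rewrite /= -IHw. Qed.

Lemma rec1_code_word (w : word bool) : rec1 (fun z => foldr code_letter z w).
Proof.
elim: w => [|l w IHw]; first exact: rec1_id.
apply: rec1_comp IHw; apply: (rec1_comp2 rec2_scale (rec1_const _)).
exact: rec1_comp rec1_succ rec1_double.
Qed.

Lemma pickle_instance (u : word bool) (ws : seq (word bool)) :
  pickle (u, ws) = 2 ^ pickle u * (2 ^ (pickle ws).+1).+1.
Proof. by rewrite expnS mul2n -[X in _ * X.*2.+1]muln1. Qed.

Lemma expand_query m n N : expand m n (query N) =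
  expand m n [:: (state_vertex (St 0), false)] ++
  iter N (cat (winv (vertex_word m n vc))) (expand m n [:: (state_vertex Check, true)]).
Proof.
rewrite /query /token -cat1s !expand_cat; congr (_ ++ _).
elim: N => [|N IHN]; first by [].
by rewrite iterS -IHN catA.
Qed.

(** The code of the instance made of the query for [2 ^ x] and of the list of
    generators whose code is [x] (see [pickle_instance]); the input [x] of the
    machine is its register 0, hence the exponent of 2 in the counter. *)
Definition diagonal_code m n x : nat :=
  2 ^ pickle (expand m n (query (2 ^ x))) * (2 ^ x.+1).+1.

Lemma rec1_diagonal_code m n : rec1 (diagonal_code m n).
Proof.
apply: (rec1_comp2 rec2_scale); last first.
  exact: rec1_comp rec1_succ (rec1_comp rec1_exp2 rec1_succ).
pose pre := expand m n [:: (state_vertex (St 0), false)].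
pose suf := expand m n [:: (state_vertex Check, true)].
pose block z := foldr code_letter z (winv (vertex_word m n vc)).
have [f fP] : rec1 (fun x => foldr code_letter (iter (2 ^ x) block (pickle suf)) pre).
  apply: rec1_comp (rec1_code_word pre) _.
  by apply: (rec1_comp2 (rec2_iter _) rec1_exp2 (rec1_const _)); apply: rec1_code_word.
exists f => x; rewrite expand_query [pickle (_ ++ _)]pickle_word foldr_cat.
have <- : iter (2 ^ x) block (pickle suf) =
  foldr code_letter 0 (iter (2 ^ x) (cat (winv (vertex_word m n vc))) suf).
  elim: (2 ^ x) => [|k IHk]; first exact: pickle_word.
  by rewrite !iterS foldr_cat -IHk.
exact: fP.
Qed.

(** * Undecidability *)

Theorem corollary3p10 (m n : nat) (hm : 1 < m) (hn : 1 < n) :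
  ~ recursively_decidable (submonoid_membership (@Gmn_gen m n)).
Proof.
case=> f decide; have [g gP] := rec1_diagonal_code m n.
pose D := RComp f (fun _ : 'I_1 => g).
have DP x y : rec_eval f [tuple diagonal_code m n x] y -> rec_eval D [tuple x] y.
  by move=> fy; exists [tuple diagonal_code m n x] => // i; rewrite (tnth_nth 0) ord1.
have [R [final machineP]] := zero_machine_rec D.
(* The machine is run on the code of its own list of generators. *)
pose ws := map (expand m n) (tokens R final); pose x := pickle ws.
pose inst := (expand m n (query (2 ^ x)), ws).
have memP : submonoid_membership (@Gmn_gen m n) inst <->
    exists N, steps R (0, 2 ^ x) (final, N).
  rewrite -(query_member hm hn) /submonoid_membership /= word_value_gval.
  by rewrite (eq_map (@word_value_gval _ _)).
have [yes no] := decide inst.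
rewrite [pickle inst]pickle_instance in yes no.
have [mem|nmem] := pselect (submonoid_membership (@Gmn_gen m n) inst).
  by have := (machineP _ _ (DP x 1 (yes mem))).1 (memP.1 mem).
by apply/nmem/memP.2/(machineP _ _ (DP x 0 (no nmem))).2.
Qed.
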